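(* For every bounded set $K\subset\mathbb R^2$ of spatial wave numbers $(\tilde k_A,\tilde k_B)$ there exists an $\varepsilon_0>0$ such that for all $\varepsilon\in(0,\varepsilon_0)$ the system $$\begin{aligned} 0&=r_A(\alpha_u+\gamma_{1,r}r_A^2+\gamma_{2,r}r_B^2)-4\varepsilon^2r_A\tilde k_A^2,\\ 0&=r_A(-\omega_A+\gamma_{1,i}r_A^2+\gamma_{2,i}r_B^2),\\ 0&=r_B(\alpha_v+\gamma_{7,r}r_A^2+\gamma_{8,r}r_B^2)-4\varepsilon^2r_B\tilde k_B^2,\\ 0&=r_B(-\omega_B-c_g\tilde k_B+\gamma_{7,i}r_A^2+\gamma_{8,i}r_B^2)-3\varepsilon^2c_dr_B\tilde k_B^2 \end{aligned}$$ has families of solutions $(r_A,\omega_A,r_B,\omega_B)$ with $r_A,r_B\ge0$, $\omega_A,\omega_B\in\mathbb R$, parametrised by $(\tilde k_A,\tilde k_B)\in K$. Specifically, there are - the trivial solution $r_A=r_B=0$; - two families of semi-trivial solutions: one with $r_B=0$, $r_A>0$ provided $\alpha_u\gamma_{1,r}<0$, and one with $r_A=0$, $r_B>0$ provided $\alpha_v\gamma_{8,r}<0$; - a family of fully nontrivial solutions with $r_A,r_B\neq0$ if $d:=\gamma_{1,r}\gamma_{8,r}-\gamma_{2,r}\gamma_{7,r}\neq0$, $\dfrac{\gamma_{8,r}\alpha_u-\gamma_{2,r}\alpha_v}{d}<0$ and $\dfrac{\gamma_{1,r}\alpha_v-\gamma_{7,r}\alpha_u}{d}<0$.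
   Context: $\alpha_u,\alpha_v,c_d\in\mathbb R$, $c_g=3c_d$, and $\gamma_j=\gamma_{j,r}+i\gamma_{j,i}\in\mathbb C$, $j=1,2,7,8$, are given coefficients. The algebraic system expresses that $$(A,B)(T,X)=\big(r_Ae^{i(\varepsilon\tilde k_AX+\omega_AT)},\,r_Be^{i(\varepsilon\tilde k_BX+\omega_BT)}\big)$$ is a space-time periodic solution of the amplitude equations $$\partial_TA=4\partial_X^2A+\alpha_uA+\gamma_1A|A|^2+\gamma_2A|B|^2,\qquad \partial_TB=(4+3ic_d)\partial_X^2B-\frac{c_g}{\varepsilon}\partial_XB+\alpha_vB+\gamma_7B|A|^2+\gamma_8B|B|^2 .$$ *)

(* Defs.v *)
From mathcomp Require Import all_boot all_order all_algebra.
From mathcomp Require Import complex.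
From mathcomp Require Import all_classical all_reals all_analysis.

Set Implicit Arguments.
Unset Strict Implicit.
Unset Printing Implicit Defensive.

Import Order.TTheory GRing.Theory Num.Theory.
Import numFieldNormedType.Exports.

Local Open Scope classical_set_scope.
Local Open Scope ring_scope.

(* Real and imaginary parts, divided by e^{i(..)}, of the amplitude equations
     A_T = 4 A_XX + alpha_u A + gamma1 A|A|^2 + gamma2 A|B|^2,
     B_T = (4 + 3 i c_d) B_XX - (c_g / eps) B_X + alpha_v B
           + gamma7 B|A|^2 + gamma8 B|B|^2
   at A = rA e^{i(eps kA X + wA T)}, B = rB e^{i(eps kB X + wB T)}. *)
Definition amplitude_system (R : realType) (alpha_u alpha_v c_d c_g : R)
    (gamma1 gamma2 gamma7 gamma8 : R[i]) (eps kA kB rA wA rB wB : R) : Prop :=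
  [/\ 0 = rA * (alpha_u + complex.Re gamma1 * rA ^+ 2
                + complex.Re gamma2 * rB ^+ 2)
          - 4 * eps ^+ 2 * rA * kA ^+ 2,
      0 = rA * (- wA + complex.Im gamma1 * rA ^+ 2
                + complex.Im gamma2 * rB ^+ 2),
      0 = rB * (alpha_v + complex.Re gamma7 * rA ^+ 2
                + complex.Re gamma8 * rB ^+ 2)
          - 4 * eps ^+ 2 * rB * kB ^+ 2
    & 0 = rB * (- wB - c_g * kB + complex.Im gamma7 * rA ^+ 2
                + complex.Im gamma8 * rB ^+ 2)
          - 3 * eps ^+ 2 * c_d * rB * kB ^+ 2].

(* The values of rA, wA, rB, wB outside K are irrelevant.  [sys kA kB rA wA rB wB]
   is the system to be solved, [P rA rB] the type of amplitudes required. *)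
Definition has_solution_family (R : realType)
    (sys : R -> R -> R -> R -> R -> R -> Prop) (K : set (R * R))
    (P : R -> R -> Prop) : Prop :=
  exists rA wA rB wB : R * R -> R,
    forall k : R * R, K k ->
      [/\ 0 <= rA k, 0 <= rB k, P (rA k) (rB k)
        & sys k.1 k.2 (rA k) (wA k) (rB k) (wB k)].

(* Main.v *)
(* The real-part equations are linear in the squares X = rA^2 and Y = rB^2, with
   data alpha_u - 4 eps^2 kA^2 and alpha_v - 4 eps^2 kB^2; the imaginary-part
   equations then merely define wA and wB.  The strict sign conditions which
   make X and Y positive at eps = 0 survive for small eps, uniformly over the
   bounded set of wave numbers. *)
Require Import Defs.
From mathcomp Require Import all_boot all_order all_algebra.
From mathcomp Require Import complex.
From mathcomp Require Import all_classical all_reals all_analysis.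
From mathcomp Require Import ring lra.

Set Implicit Arguments.
Unset Strict Implicit.
Unset Printing Implicit Defensive.

Import Order.TTheory GRing.Theory Num.Theory.
Import numFieldNormedType.Exports.

Local Open Scope classical_set_scope.
Local Open Scope ring_scope.

(** The assumption [c < 0] sits behind the choice of [e0] because one threshold must be fixed before
    it is known which families exist; for [c >= 0] any positive value, here 1, will do. *)
Lemma lt0_perturb (R : realFieldType) (c p q N : R) (N0 : 0 <= N) :
  exists2 e0 : R, 0 < e0 &
    c < 0 -> forall e s t : R, 0 < e -> e < e0 -> 0 <= s <= N -> 0 <= t <= N ->
      c + e ^+ 2 * (p * s + q * t) < 0.
Proof.
have [c0|c0] := ltP c 0; last first.
  by exists 1.
(* [D] bounds [p * s + q * t], and the added 1 makes it a legal divisor. Since [e < 1] gives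
   [e ^+ 2 <= e], the perturbation is at most [e * D < - c]. *)
set D := (`|p| + `|q|) * N + 1.
have D0 : 0 < D by rewrite ltr_wpDl// mulr_ge0// addr_ge0.
exists (Num.min 1 (- c / D)); first by rewrite lt_min ltr01 divr_gt0// oppr_gt0.
move=> _ e s t e0; rewrite lt_min ltr_pdivlMr// => /andP[e1 eD].
move=> /andP[s0 sN] /andP[t0 tN].
have mono (a u : R) : 0 <= u -> u <= N -> a * u <= `|a| * N.
  move=> u0 uN; apply: (le_trans (ler_norm _)).
  by rewrite normrM (ger0_norm u0) ler_wpM2l.
have pqD : p * s + q * t <= D.
  by rewrite (le_trans (lerD (mono p s s0 sN) (mono q t t0 tN)))// -mulrDl lerDl.
have e2e : e ^+ 2 <= e by rewrite expr2 ler_piMl// ltW.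
have h1 : e ^+ 2 * (p * s + q * t) <= e ^+ 2 * D by rewrite ler_wpM2l// sqr_ge0.
have h2 : e ^+ 2 * D <= e * D by rewrite ler_wpM2r// ltW.
lra.
Qed.

Lemma bounded_set_sqr_le (R : realType) (K : set (R * R)) : bounded_set K ->
  exists2 N : R, 0 <= N &
    forall k, K k -> 0 <= k.1 ^+ 2 <= N /\ 0 <= k.2 ^+ 2 <= N.
Proof.
(* Boundedness gives a bound only for reals strictly above [M], which may be negative. The norm on
   pairs is the maximum norm, so [L] bounds both coordinates. *)
move=> [M [_ KM]]; pose L := `|M| + 1.
have L0 : 0 <= L by rewrite addr_ge0.
have ML : M < L by rewrite (le_lt_trans (ler_norm _))// ltrDl.
exists (L ^+ 2); first exact: sqr_ge0.
move=> k /(KM _ ML) /=; rewrite prod_normE ge_max => /andP[k1 k2].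
by rewrite !sqr_ge0 /= -[k.1 ^+ 2]real_normK ?num_real// -[k.2 ^+ 2]real_normK
  ?num_real// !lerXn2r ?nnegrE.
Qed.

(** Each disjunction mirrors a factored real-part equation: either the amplitude vanishes or its
    bracket does. *)
Lemma solution_family_of_squares (R : realType) (alpha_u alpha_v c_d c_g : R)
    (gamma1 gamma2 gamma7 gamma8 : R[i]) (eps : R) (K : set (R * R))
    (P : R -> R -> Prop) (X Y : R * R -> R) :
  (forall k, K k ->
    [/\ 0 <= X k /\ 0 <= Y k,
        P (Num.sqrt (X k)) (Num.sqrt (Y k)),
        X k = 0 \/ alpha_u + complex.Re gamma1 * X k + complex.Re gamma2 * Y k
                   = 4 * eps ^+ 2 * k.1 ^+ 2
      & Y k = 0 \/ alpha_v + complex.Re gamma7 * X k + complex.Re gamma8 * Y k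
                   = 4 * eps ^+ 2 * k.2 ^+ 2]) ->
  has_solution_family (amplitude_system alpha_u alpha_v c_d c_g
    gamma1 gamma2 gamma7 gamma8 eps) K P.
Proof.
move=> XY.
exists (fun k => Num.sqrt (X k)),
  (* Both frequencies cancel their whole imaginary-part equation, so it holds whether or not the
     amplitude is zero. *)
  (fun k => complex.Im gamma1 * X k + complex.Im gamma2 * Y k),
  (fun k => Num.sqrt (Y k)),
  (fun k => complex.Im gamma7 * X k + complex.Im gamma8 * Y k - c_g * k.2
            - 3 * eps ^+ 2 * c_d * k.2 ^+ 2).
move=> k /XY[[X0 Y0] PXY eX eY]; split; rewrite ?sqrtr_ge0//.
split; rewrite !sqr_sqrtr//; try by ring.
- by case: eX => [->|->]; rewrite ?sqrtr0; ring.
- by case: eY => [->|->]; rewrite ?sqrtr0; ring.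
Qed.

(** The semi-trivial conditions are signs of products, while the squared amplitudes are quotients;
    the two differ by the positive factor [y ^+ 2]. *)
Lemma oppr_div_gt0 (R : realFieldType) (x y : R) : x * y < 0 -> 0 < - (x / y).
Proof.
move=> xy; have y0 : y != 0 by apply: contraTneq xy => ->; rewrite mulr0 ltxx.
have -> : - (x / y) = - (x * y) / y ^+ 2 by field.
by rewrite divr_gt0 ?oppr_gt0// exprn_even_gt0.
Qed.

Theorem proposition3p6 (R : realType) (alpha_u alpha_v c_d c_g : R)
    (gamma1 gamma2 gamma7 gamma8 : R[i]) (c_gE : c_g = 3 * c_d)
    (K : set (R * R)) (bounded_K : bounded_set K) :
  exists2 eps0 : R, 0 < eps0 &
    forall eps : R, 0 < eps -> eps < eps0 ->
      let sys := amplitude_system alpha_u alpha_v c_d c_g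
                   gamma1 gamma2 gamma7 gamma8 eps in
      let d := complex.Re gamma1 * complex.Re gamma8
               - complex.Re gamma2 * complex.Re gamma7 in
      [/\ forall (k : R * R) (wA wB : R), K k -> sys k.1 k.2 0 wA 0 wB,
          alpha_u * complex.Re gamma1 < 0 ->
            has_solution_family sys K (fun rA rB => rB = 0 /\ 0 < rA),
          alpha_v * complex.Re gamma8 < 0 ->
            has_solution_family sys K (fun rA rB => rA = 0 /\ 0 < rB)
        & d != 0 ->
          (complex.Re gamma8 * alpha_u - complex.Re gamma2 * alpha_v) / d < 0 ->
          (complex.Re gamma1 * alpha_v - complex.Re gamma7 * alpha_u) / d < 0 ->
            has_solution_family sys K (fun rA rB => rA != 0 /\ rB != 0)].
Proof.
have [N N0 KN] := bounded_set_sqr_le bounded_K.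
set g1 := complex.Re gamma1; set g2 := complex.Re gamma2.
set g7 := complex.Re gamma7; set g8 := complex.Re gamma8.
pose d := g1 * g8 - g2 * g7.
(* The coefficients come from replacing [alpha_u], [alpha_v] by [alpha_u - 4 * eps ^+ 2 * s],
   [alpha_v - 4 * eps ^+ 2 * t] in the four sign conditions, with [s], [t] the squared wave
   numbers. *)
have [e1 e1_gt0 H1] := lt0_perturb (alpha_u * g1) (- 4 * g1) 0 N0.
have [e2 e2_gt0 H2] := lt0_perturb (alpha_v * g8) 0 (- 4 * g8) N0.
have [e3 e3_gt0 H3] := lt0_perturb ((g8 * alpha_u - g2 * alpha_v) / d)
  (- 4 * g8 / d) (4 * g2 / d) N0.
have [e4 e4_gt0 H4] := lt0_perturb ((g1 * alpha_v - g7 * alpha_u) / d)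
  (4 * g7 / d) (- 4 * g1 / d) N0.
exists (Num.min (Num.min e1 e2) (Num.min e3 e4)).
  by rewrite !lt_min e1_gt0 e2_gt0 e3_gt0.
move=> eps eps_gt0; rewrite !lt_min => /andP[/andP[lt1 lt2] /andP[lt3 lt4]] sys.
rewrite -/d.
pose a (k : R * R) := alpha_u - 4 * eps ^+ 2 * k.1 ^+ 2.
pose b (k : R * R) := alpha_v - 4 * eps ^+ 2 * k.2 ^+ 2.
split=> [k wA wB _|neg|neg|d0 neg3 neg4].
- by split; ring.
(* With [Y = 0] the first bracket reduces to [a k + g1 * X = 0]. *)
- apply: (@solution_family_of_squares _ _ _ _ _ _ _ _ _ _ _ _
    (fun k => - (a k / g1)) (fun=> 0)) => k /KN[k1 k2].
  have g10 : g1 != 0 by apply: contraTneq neg => ->; rewrite mulr0 ltxx.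
  have X0 : 0 < - (a k / g1).
    apply: oppr_div_gt0; rewrite /a.
    by have := H1 neg _ _ _ eps_gt0 lt1 k1 k2; lra.
  rewrite sqrtr0 sqrtr_gt0; split=> //; first by split=> //; exact: ltW.
  + by right; rewrite -/g1 /a; field.
  + by left.
- apply: (@solution_family_of_squares _ _ _ _ _ _ _ _ _ _ _ _
    (fun=> 0) (fun k => - (b k / g8))) => k /KN[k1 k2].
  have g80 : g8 != 0 by apply: contraTneq neg => ->; rewrite mulr0 ltxx.
  have Y0 : 0 < - (b k / g8).
    apply: oppr_div_gt0; rewrite /b.
    by have := H2 neg _ _ _ eps_gt0 lt2 k1 k2; lra.
  rewrite sqrtr0 sqrtr_gt0; split=> //; first by split=> //; exact: ltW.
  + by left.
  + by right; rewrite -/g8 /b; field.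
- (* Cramer's rule *)
  pose X k := - ((g8 * a k - g2 * b k) / d).
  pose Y k := - ((g1 * b k - g7 * a k) / d).
  apply: (@solution_family_of_squares _ _ _ _ _ _ _ _ _ _ _ _ X Y)
    => k /KN[k1 k2].
  have X0 : 0 < X k.
    rewrite oppr_gt0 /a /b.
    by have := H3 neg3 _ _ _ eps_gt0 lt3 k1 k2; lra.
  have Y0 : 0 < Y k.
    rewrite oppr_gt0 /a /b.
    by have := H4 neg4 _ _ _ eps_gt0 lt4 k1 k2; lra.
  split; first by rewrite !ltW.
  + by rewrite !sqrtr_eq0 -!ltNge.
  + by right; rewrite /X /Y -/g1 -/g2 /a /b /d; field.
  + by right; rewrite /X /Y -/g7 -/g8 /a /b /d; field.
Qed.
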